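(* Let $\xi \in \Xi$ be a design whose information matrix $\mathbf M = \mathbf M(\xi)$ is nonsingular, and let $\lambda_1 = \lambda_1(\mathbf M)$. Take any number $s \ge 1$ of normalized (unit-norm) eigenvectors $\mathbf v_1,\ldots,\mathbf v_s$ of $\mathbf M$ and any real numbers $\alpha_1,\ldots,\alpha_s$ such that $\alpha_i \ge 0$ for all $i$ and $\sum_{i=1}^s \alpha_i = 1$, and set $$\mathbf Z = \sum_{i=1}^s \alpha_i \mathbf v_i \mathbf v_i^\top \quad\text{and}\quad h = \max_{x \in \mathfrak X} \mathrm{tr}(\mathbf H(x)\mathbf Z).$$ Then $h \ge \lambda_1$. If $h = \lambda_1$, then $\xi$ is $E$-optimal. If $h > \lambda_1$, then $$g_h(x,y) := \sum_{i=1}^m \frac{\mathbf u_i^\top \mathbf H(x) \mathbf u_i}{(\lambda_i(\mathbf M) - h)\,y + \lambda_1} \ge 1$$ for any $x \in \mathfrak X$ supporting an $E$-optimal design and for any $y \in [0, \lambda_1/(h-\lambda_1))$, where $\mathbf u_1,\ldots,\mathbf u_m$ are orthonormal eigenvectors of $\mathbf M$ corresponding to $\lambda_1(\mathbf M) \le \cdots \le \lambda_m(\mathbf M)$, respectively.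
   Context: $\mathfrak X$ is a finite (nonempty) set, called the design space; its elements are design points. $\mathfrak S^m_+$ denotes the set of all real symmetric nonnegative definite (positive semidefinite) $m\times m$ matrices. To each $x \in \mathfrak X$ there is assigned a matrix $\mathbf H(x) \in \mathfrak S^m_+$ (the elementary information matrix of $x$). $\Xi$ is the set of all (approximate) designs, i.e., probability measures on $\mathfrak X$; for $\xi \in \Xi$ the information matrix is $\mathbf M(\xi) = \sum_{x \in \mathfrak X} \xi(x)\mathbf H(x)$. For a matrix $\mathbf M \in \mathfrak S^m_+$, $\lambda_1(\mathbf M) \le \cdots \le \lambda_m(\mathbf M)$ are its eigenvalues, counted with multiplicity. A design is $E$-optimal if it maximizes $\lambda_1(\mathbf M(\xi))$ over $\xi \in \Xi$. A point $x$ supports a design $\xi$ if $\xi(x) > 0$. It is assumed throughout that there exists a design $\xi \in \Xi$ with $\mathbf M(\xi)$ nonsingular. *)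

(* Defs.v *)
From mathcomp Require Import all_boot all_order all_algebra.
From mathcomp Require Import reals.
From mathcomp Require Import polyrcf.

Set Implicit Arguments.
Unset Strict Implicit.
Unset Printing Implicit Defensive.

Import Order.TTheory GRing.Theory Num.Theory.
Local Open Scope ring_scope.

Section LinearAlgebra.
Variables (R : realType) (m : nat).
Implicit Types (A M : 'M[R]_m) (u v : 'cV[R]_m).

Definition dotp u v : R := (u^T *m v) 0 0.

Definition norm2 v : R := Num.sqrt (dotp v v).

Definition quadform A v : R := (v^T *m A *m v) 0 0.

Definition nonneg_definite A : Prop :=
  A \is symmetricmx /\ forall v, 0 <= quadform A v.

(* The library's [eigenvalue] and [eigenspace] act on row vectors. *)
Definition eigenvector M v : Prop :=
  v != 0 /\ exists a : R, M *m v = a *: v.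

(* Since [rootsR] lists the distinct real roots in increasing order, this is
   the nondecreasing list of real eigenvalues, each repeated according to its
   algebraic multiplicity; it has length m when M is symmetric. *)
Definition eigenvalues M : seq R :=
  flatten [seq nseq (mup a (char_poly M)) a | a <- rootsR (char_poly M)].

(* Indices start at 0: [lambda M i] is the (i+1)-st smallest eigenvalue. *)
Definition lambda M (i : nat) : R := nth 0 (eigenvalues M) i.

Definition lambda_min M : R := lambda M 0.

Definition ordered_eigenbasis M (u : 'I_m -> 'cV[R]_m) : Prop :=
  (forall i j, dotp (u i) (u j) = (i == j)%:R) /\
  (forall i, M *m u i = lambda M i *: u i).

End LinearAlgebra.

Section Designs.
Variables (R : realType) (X : finType).

(* A probability measure on X is given by its point masses. *)
Definition design (xi : X -> R) : Prop :=
  (forall x, 0 <= xi x) /\ \sum_x xi x = 1.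

Definition supports (x : X) (xi : X -> R) : Prop := 0 < xi x.

Definition is_max (F : X -> R) (h : R) : Prop :=
  (exists x, F x = h) /\ (forall x, F x <= h).

Variables (m : nat) (H : X -> 'M[R]_m).

Definition infomx (xi : X -> R) : 'M[R]_m := \sum_x xi x *: H x.

Definition E_optimal (xi : X -> R) : Prop :=
  design xi /\
  forall zeta, design zeta -> lambda_min (infomx zeta) <= lambda_min (infomx xi).

Definition g_fun (M : 'M[R]_m) (u : 'I_m -> 'cV[R]_m) (h : R) (x : X) (y : R) : R :=
  \sum_(i < m) quadform (H x) (u i) / ((lambda M i - h) * y + lambda_min M).

End Designs.

(* Main.v *)
Require Import Defs.
From mathcomp Require Import all_boot all_order all_algebra.
From mathcomp Require Import reals polyrcf complex.
From mathcomp Require Import ring lra.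

(** The number [lambda_min N] is the minimum of the Rayleigh quotient of a
    symmetric matrix [N], so it is at most [tr (N Z)] for every [Z] that is a
    convex combination of projections on unit vectors. For [N] the information
    matrix of a design, [tr (N Z)] is an average of the numbers [tr (H x Z)],
    hence at most [h]. Thus [h] bounds [lambda_min] over all designs
    ([lambda_min_le_design_bound]), which gives both [lambda_1 <= h] and the
    optimality of [xi] in case of equality.

    For the inequality on support points, put
    [D = y M + (lambda_1 - h y) I], where [M = M(xi)]. It is positive definite
    for the given range of [y], the [u i] are eigenvectors of [D], and
    [g = tr (H x D^-1)]. Two facts are combined.

    - A positive semidefinite [B] satisfies [B <= tr (B D^-1) D] in the
      Loewner order. This is a weighted Cauchy-Schwarz inequality
      ([psd_quadform_sum_le]). Hence [H x <= g y M + g (lambda_1 - h y) I].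
    - Suppose [H x <= p M + q I] with [0 <= p], and let [x] support an
      E-optimal design [zeta] with optimal value [l]. Then [l <= p l + q]
      ([E_optimal_support_le]): otherwise, replacing in [zeta] a small mass
      at [x] by [p] times that mass of [xi], and renormalizing, would increase
      [lambda_min].

    Together they yield [l <= g (lambda_1 - y (h - l))]. Since
    [lambda_1 <= l <= h], the right-hand side is at most [g l], and [0 < l]
    gives [1 <= g]. *)

Set Implicit Arguments.
Unset Strict Implicit.
Unset Printing Implicit Defensive.

Import Order.TTheory GRing.Theory Num.Theory.
Local Open Scope ring_scope.
Local Open Scope sesquilinear_scope.

(** * Real symmetric matrices and their smallest eigenvalue *)

Lemma symmetricmx_trP (R : realType) (m : nat) (A : 'M[R]_m) :
  reflect (A^T = A) (A \is symmetricmx).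
Proof.
apply: (iffP (is_hermitianmxP _ _ _)); rewrite expr0 scale1r.
  by move=> sA; rewrite [RHS]sA; apply/matrixP => i j; rewrite !mxE.
by move=> sA; rewrite -[LHS]sA; apply/matrixP => i j; rewrite !mxE.
Qed.

Section RealSymmetric.
Variables (R : realType) (m : nat).
Implicit Types (A B H : 'M[R]_m) (v w : 'cV[R]_m).

Lemma dotpE v w : dotp v w = \sum_i v i 0 * w i 0.
Proof. by rewrite /dotp mxE; apply: eq_bigr => i _; rewrite mxE. Qed.

Lemma dotp_ge0 v : 0 <= dotp v v.
Proof. by rewrite dotpE sumr_ge0 // => i _; rewrite -expr2 sqr_ge0. Qed.

Lemma dotp_gt0 v : v != 0 -> 0 < dotp v v.
Proof.
move=> v0; rewrite lt_def dotp_ge0 andbT dotpE; apply: contra v0 => /eqP S0.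
apply/eqP/colP => i; rewrite mxE; apply/eqP; rewrite -sqrf_eq0 expr2.
by apply/eqP/(psumr_eq0P _ S0) => // j _; rewrite -expr2 sqr_ge0.
Qed.

Lemma quadformD A B v : quadform (A + B) v = quadform A v + quadform B v.
Proof. by rewrite /quadform mulmxDr mulmxDl mxE. Qed.

Lemma quadformZ a A v : quadform (a *: A) v = a * quadform A v.
Proof. by rewrite /quadform -scalemxAr -scalemxAl mxE. Qed.

Lemma quadform_sum (I : finType) (c : I -> R) (B : I -> 'M[R]_m) v :
  quadform (\sum_i c i *: B i) v = \sum_i c i * quadform (B i) v.
Proof.
elim/big_rec2: _ => [|i r B' _ <-]; first by rewrite /quadform mulmx0 mul0mx mxE.
by rewrite quadformD quadformZ.
Qed.

Lemma mxtrace_mul_outer A v : \tr (A *m (v *m v^T)) = quadform A v.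
Proof. by rewrite mulmxA mxtrace_mulC mulmxA trace_mx11. Qed.

Lemma quadform_eigenvector A v a :
  A *m v = a *: v -> quadform A v = a * dotp v v.
Proof. by move=> Av; rewrite /quadform -mulmxA Av -scalemxAr mxE. Qed.

(** The [c i] are the squared moduli of the coordinates of [v] in a unitary
    eigenbasis of the complexification of [A]. They are real, and so are the
    diagonal entries [d i], so the complex spectral theorem yields all that is
    needed about real quadratic forms without producing a real eigenbasis. *)
Lemma symmetric_spectral_decomposition A : A^T = A ->
  exists d : 'I_m -> R, (forall i, eigenvalue A (d i)) /\
    forall v, exists c : 'I_m -> R,
      [/\ forall i, 0 <= c i, dotp v v = \sum_i c i
        & quadform A v = \sum_i d i * c i].
Proof.
move=> sA.
pose f : {rmorphism R -> R[i]} := real_complex R; pose AC := map_mx f A.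
have symAC : AC \is hermsymmx.
  apply/is_hermitianmxP; rewrite expr0 scale1r.
  apply/matrixP => i j; rewrite !mxE -[in LHS]sA mxE.
  by apply/esym/CrealP; rewrite complex_real.
pose P := spectralmx AC; pose D := spectral_diag AC.
have PU : P \is unitarymx := spectral_unitarymx AC.
have Punit := unitarymx_unit PU.
have AE : AC = P ^t* *m diag_mx D *m P.
  rewrite -invmx_unitary //; apply/orthomx_spectralP.
  exact: hermitian_normalmx.
have Dreal i : f (complex.Re (D 0 i)) = D 0 i.
  apply: RRe_real; have /mxOverP := hermitian_spectral_diag_real symAC.
  exact.
exists (fun i => complex.Re (D 0 i)); split=> [i|v].
  rewrite -(eigenvalue_map f) Dreal; apply/eigenvalueP; exists (row i P).
    rewrite -/AC -row_mul AE !mulmxA (unitarymxP PU) mul1mx.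
    by rewrite row_mul row_diag_mx -scalemxAl -rowE.
  apply: contraL Punit => /eqP Pi0; rewrite unitmxE unitfE negbK.
  by rewrite (expand_det_row _ i) big1 // => j _;
    move/rowP/(_ j): Pi0; rewrite !mxE => ->; rewrite mul0r.
(* The coordinates of v in the eigenbasis formed by the rows of P. *)
pose w := P *m map_mx f v.
have wT : (map_mx f v)^T *m P ^t* = w ^t*.
  rewrite /w trmx_mul map_mxM; congr (_ *m _).
  by apply/matrixP => i j; rewrite !mxE; apply/esym/CrealP; rewrite complex_real.
have wE i : f (complex.Re (`|w i 0| ^+ 2)) = `|w i 0| ^+ 2.
  by apply: RRe_real; rewrite ger0_real ?exprn_ge0.
exists (fun i => complex.Re (`|w i 0| ^+ 2)); split=> [i||].
- by rewrite -ler0c wE exprn_ge0.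
- apply: (@complexI R); rewrite -/f rmorph_sum /=.
  transitivity (((map_mx f v)^T *m map_mx f v) 0 0).
    by rewrite /dotp map_trmx -map_mxM [RHS]mxE.
  rewrite -[X in _ *m X]mul1mx -(mulVmx Punit) invmx_unitary // !mulmxA wT.
  rewrite -mulmxA -/w mxE; apply: eq_bigr => i _.
  by rewrite wE !mxE normCKC.
- apply: (@complexI R); rewrite -/f rmorph_sum /=.
  transitivity (((map_mx f v)^T *m AC *m map_mx f v) 0 0).
    by rewrite /quadform map_trmx -!map_mxM [RHS]mxE.
  rewrite AE !mulmxA wT -2!mulmxA -/w mxE; apply: eq_bigr => i _.
  by rewrite rmorphM Dreal wE mul_diag_mx !mxE normCKC mulrCA.
Qed.

(** The list of eigenvalues starts with the first root of [char_poly A],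
    because a root has positive multiplicity. The eigenvalue [a] makes sure
    that the list is not empty, so that [lambda_min A] is not the default
    value 0. *)
Lemma lambda_min_eigenvalue A a :
  eigenvalue A a -> eigenvalue A (lambda_min A) /\ lambda_min A <= a.
Proof.
rewrite !eigenvalue_root_char /lambda_min /lambda /eigenvalues.
have p0 : char_poly A != 0 by rewrite monic_neq0 ?char_poly_monic.
have rP x : root (char_poly A) x = (x \in rootsR (char_poly A)).
  by rewrite -(roots_on_rootsR p0) in_itv.
rewrite rP; have := sorted_roots (- cauchy_bound (char_poly A))
  (cauchy_bound (char_poly A)) (char_poly A); rewrite -/(rootsR _).
case E : (rootsR _) => [//|r s] /= rs.
have : root (char_poly A) r by rewrite rP E mem_head.
rewrite -dvdp_XsubCl XsubC_dvd //; case F : (mup _ _) => [//|k] _ /=.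
rewrite rP E mem_head in_cons; move=> /orP H; split=> //.
case: H => [/eqP->//|sa].
by rewrite ltW // (allP (order_path_min lt_trans rs)).
Qed.

Lemma lambda_min_rayleigh A v : A^T = A ->
  lambda_min A * dotp v v <= quadform A v.
Proof.
move=> /symmetric_spectral_decomposition [d [dA /(_ v) [c [c0 -> ->]]]].
rewrite mulr_sumr ler_sum // => i _.
by have [_ le_d] := lambda_min_eigenvalue (dA i); rewrite ler_wpM2r.
Qed.

Lemma lambda_min_eigenvector A : (0 < m)%N -> A^T = A ->
  exists2 w : 'cV[R]_m, w != 0 & A *m w = lambda_min A *: w.
Proof.
move=> m0 sA.
have [d [/(_ (Ordinal m0)) dA _]] := symmetric_spectral_decomposition sA.
have [/eigenvalueP [w wA w0] _] := lambda_min_eigenvalue dA.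
exists w^T; first by rewrite trmx_eq0.
by rewrite -[in LHS]sA -trmx_mul wA linearZ.
Qed.

Lemma lambda_min_ge A b : (0 < m)%N -> A^T = A ->
  (forall v, b * dotp v v <= quadform A v) -> b <= lambda_min A.
Proof.
move=> m0 sA bA; have [w w0 Aw] := lambda_min_eigenvector m0 sA.
by rewrite -(ler_pM2r (dotp_gt0 w0)) -(quadform_eigenvector Aw).
Qed.

Lemma lambda_min_gt0 A : (0 < m)%N -> nonneg_definite A ->
  A \in unitmx -> 0 < lambda_min A.
Proof.
move=> m0 [/symmetricmx_trP sA A0] uA.
have [w w0 Aw] := lambda_min_eigenvector m0 sA.
rewrite lt_def; apply/andP; split; last first.
  by apply: lambda_min_ge => // v; rewrite mul0r.
apply: contraNneq w0 => l0; move: Aw; rewrite l0 scale0r => Aw.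
by rewrite -(mulKmx uA w) Aw mulmx0.
Qed.

(** * A weighted Cauchy-Schwarz inequality for quadratic forms *)

(** The difference of the two sides is, up to the factor [c * e], the value of
    the form at [b e v - a c w]. *)
Lemma psd_cross_le H (a b c e : R) v w :
  nonneg_definite H -> 0 < c -> 0 < e ->
  2 * (a * b * (v^T *m H *m w) 0 0)
    <= quadform H v / c * (e * b ^+ 2) + quadform H w / e * (c * a ^+ 2).
Proof.
case=> /symmetricmx_trP sH /(_ ((b * e) *: v - (a * c) *: w)) + c0 e0.
have sym : (w^T *m H *m v) 0 0 = (v^T *m H *m w) 0 0.
  transitivity ((w^T *m H *m v)^T 0 0); first by rewrite [RHS]mxE.
  by rewrite !trmx_mul trmxK sH mulmxA.
have -> : quadform H ((b * e) *: v - (a * c) *: w)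
  = (c * e) * (quadform H v / c * (e * b ^+ 2) + quadform H w / e * (c * a ^+ 2)
               - 2 * (a * b * (v^T *m H *m w) 0 0)).
  rewrite /quadform [(_ - _)^T]linearB /= ![(_ *: _)^T]linearZ /=.
  rewrite !(mulmxBl, mulmxBr) -!scalemxAl -!scalemxAr !scalerA.
  move: sym; set vv := v^T *m H *m v; set ww := w^T *m H *m w.
  set vw := v^T *m H *m w; set wv := w^T *m H *m v => sym.
  clearbody vv ww vw wv.
  by rewrite !mxE sym; field; rewrite !gt_eqF.
by rewrite pmulr_rge0 ?mulr_gt0 // subr_ge0.
Qed.

(** When the [u i] form an orthonormal basis, this is the Loewner inequality
    [H <= tr (H D^-1) D] for the matrix [D] with eigenvectors [u i] and
    eigenvalues [d i]. As for Lagrange's identity, twice the difference of the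
    sides is a sum over pairs of the terms of [psd_cross_le]. *)
Lemma psd_quadform_sum_le H (I : finType) (u : I -> 'cV[R]_m) (a d : I -> R) :
  nonneg_definite H -> (forall i, 0 < d i) ->
  quadform H (\sum_i a i *: u i)
    <= (\sum_i quadform H (u i) / d i) * \sum_i d i * a i ^+ 2.
Proof.
move=> Hpsd d0.
have -> : quadform H (\sum_i a i *: u i)
    = \sum_i \sum_j a i * a j * ((u i)^T *m H *m u j) 0 0.
  rewrite /quadform [(\sum_i _)^T]linear_sum /= !mulmx_suml summxE.
  apply: eq_bigr => i _; rewrite mulmx_sumr summxE; apply: eq_bigr => j _.
  rewrite -scalemxAr [(_ *: _)^T]linearZ /= -!scalemxAl scalerA mxE.
  by rewrite [a j * _]mulrC.
rewrite -(ler_pM2l (ltr0Sn R 1)).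
have -> : 2 * ((\sum_i quadform H (u i) / d i) * \sum_i d i * a i ^+ 2)
  = \sum_i \sum_j (quadform H (u i) / d i * (d j * a j ^+ 2)
                    + quadform H (u j) / d j * (d i * a i ^+ 2)).
  under [RHS]eq_bigr => i _ do rewrite big_split /=.
  rewrite big_split /= [X in _ = _ + X]exchange_big /= mulr_natl mulr2n.
  by congr (_ + _); rewrite mulr_suml; apply: eq_bigr => i _; rewrite mulr_sumr.
rewrite mulr_sumr; apply: ler_sum => i _; rewrite mulr_sumr; apply: ler_sum => j _.
exact: psd_cross_le.
Qed.

Lemma orthonormal_expansion (u : 'I_m -> 'cV[R]_m) w :
  (forall i j, dotp (u i) (u j) = (i == j)%:R) ->
  w = \sum_i dotp (u i) w *: u i.
Proof.
move=> uu; pose U : 'M[R]_m := \matrix_(i, j) u j i 0.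
have UU : U^T *m U = 1%:M.
  apply/matrixP => i j; rewrite !mxE -uu dotpE.
  by apply: eq_bigr => k _; rewrite !mxE.
rewrite -[LHS]mul1mx -(mulmx1C UU) -mulmxA.
apply/colP => i; rewrite mxE summxE; apply: eq_bigr => j _.
rewrite !mxE mulrC dotpE; congr (_ * _).
by apply: eq_bigr => k _; rewrite !mxE.
Qed.

Lemma quadform_eigenbasis A (u : 'I_m -> 'cV[R]_m) (a : 'I_m -> R) w :
  (forall i j, dotp (u i) (u j) = (i == j)%:R) ->
  (forall i, A *m u i = a i *: u i) ->
  quadform A w = \sum_i a i * dotp (u i) w ^+ 2.
Proof.
move=> uu uA.
rewrite /quadform -mulmxA {2}(orthonormal_expansion w uu) !mulmx_sumr summxE.
apply: eq_bigr => i _; rewrite -scalemxAr uA scalerA -scalemxAr mxE.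
rewrite -/(dotp w (u i)) expr2 mulrCA mulrA; congr (_ * _).
by rewrite !dotpE; apply: eq_bigr => k _; rewrite mulrC.
Qed.

End RealSymmetric.

(** * Bounds on the optimal value of the E-criterion *)

Section Designs.
Variables (R : realType) (X : finType) (m : nat) (H : X -> 'M[R]_m).
Hypothesis H_psd : forall x, nonneg_definite (H x).
Implicit Types (xi zeta : X -> R).

Lemma infomx_psd xi : design xi -> nonneg_definite (infomx H xi).
Proof.
move=> [xi0 _]; split=> [|v].
  apply/symmetricmx_trP; rewrite /infomx linear_sum /=.
  apply: eq_bigr => x _; rewrite linearZ /=.
  by have [/symmetricmx_trP -> _] := H_psd x.
rewrite quadform_sum sumr_ge0 // => x _.
by rewrite mulr_ge0 //; have [_] := H_psd x; apply.
Qed.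

Lemma infomx_sym xi : design xi -> (infomx H xi)^T = infomx H xi.
Proof. by move=> /infomx_psd [/symmetricmx_trP]. Qed.

(** Weak duality: [\tr (infomx H zeta *m Z)] is at least [lambda_min] because
    [Z] averages projections on unit vectors, and at most [h] because it is an
    average over [x]. *)
Lemma lambda_min_le_design_bound (I : finType) (v : I -> 'cV[R]_m)
    (alpha : I -> R) (h : R) zeta :
  (forall i, dotp (v i) (v i) = 1) -> (forall i, 0 <= alpha i) ->
  \sum_i alpha i = 1 ->
  (forall x, \tr (H x *m \sum_i alpha i *: (v i *m (v i)^T)) <= h) ->
  design zeta -> lambda_min (infomx H zeta) <= h.
Proof.
move=> v1 a0 a1 hh dz; set N := infomx H zeta.
pose Z := \sum_i alpha i *: (v i *m (v i)^T).
have trZ (A : 'M[R]_m) : \tr (A *m Z) = \sum_i alpha i * quadform A (v i).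
  rewrite mulmx_sumr linear_sum; apply: eq_bigr => i _.
  by rewrite -scalemxAr /= linearZ /= mxtrace_mul_outer.
apply: (@le_trans _ _ (\tr (N *m Z))).
  rewrite trZ -[leLHS]mulr1 -a1 mulr_sumr; apply: ler_sum => i _.
  rewrite mulrC ler_wpM2l // -[leLHS]mulr1 -(v1 i).
  exact/lambda_min_rayleigh/infomx_sym.
have [z0 z1] := dz.
rewrite /N /infomx mulmx_suml linear_sum -[leRHS]mul1r -z1 mulr_suml.
apply: ler_sum => x _.
by rewrite -scalemxAl /= linearZ /= ler_wpM2l // hh.
Qed.

(** A first-order optimality condition. Moving a mass [e] away from [x] and
    adding [e * p] times [xi] changes the information matrix by
    [e (p M(xi) - H x) >= - e q I] and the total mass by [e (p - 1)]. After
    normalization the smallest eigenvalue is at least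
    [(l - e q) / (1 + e (p - 1))], which cannot exceed the optimum [l]. *)
Lemma E_optimal_support_le zeta xi x (p q : R) : (0 < m)%N ->
  E_optimal H zeta -> supports x zeta -> design xi -> 0 <= p ->
  (forall w, quadform (H x) w
             <= p * quadform (infomx H xi) w + q * dotp w w) ->
  lambda_min (infomx H zeta) <= p * lambda_min (infomx H zeta) + q.
Proof.
move=> m0 [dz opt] zx dxi p0 Hx; have [z0 z1] := dz; have [xi0 xi1] := dxi.
have zx1 : zeta x <= 1 by rewrite -z1 (bigD1 x) //= lerDl sumr_ge0.
(* Half the mass at x: the full mass would leave nothing to normalize if zeta
   is concentrated at x and p = 0. *)
have [e [e0 ex e1]] : exists e, [/\ 0 < e, e <= zeta x & e < 1].
  by rewrite /supports in zx; exists (zeta x / 2); split; lra.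
pose n := 1 - e + e * p.
have n0 : 0 < n by rewrite ltr_pwDl ?subr_gt0 // mulr_ge0 // ltW.
pose zeta' z := n^-1 * (zeta z - e * (z == x)%:R + e * p * xi z).
have sumx (F : X -> R) : \sum_z (z == x)%:R * F z = F x.
  rewrite (bigD1 x) //= eqxx mul1r big1 ?addr0 // => z /negPf ->.
  by rewrite mul0r.
have dz' : design zeta'.
  split=> [z|].
    rewrite /zeta' mulr_ge0 ?invr_ge0 ?(ltW n0) // addr_ge0 //.
      by rewrite subr_ge0; case: eqP => [->|_]; rewrite ?mulr1 ?mulr0.
    by rewrite mulr_ge0 // mulr_ge0 // ltW.
  rewrite -mulr_sumr big_split /= sumrB -!mulr_sumr z1 xi1.
  have := sumx (fun=> 1); under eq_bigr do rewrite mulr1.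
  by move=> ->; rewrite !mulr1 mulVf // gt_eqF.
set l := lambda_min (infomx H zeta).
have low : n^-1 * (l - e * q) <= lambda_min (infomx H zeta').
  apply: lambda_min_ge => // [|w]; first exact: infomx_sym.
  rewrite quadform_sum; under eq_bigr do rewrite -mulrA.
  rewrite -mulr_sumr -mulrA ler_pM2l ?invr_gt0 //.
  under eq_bigr do rewrite mulrDl mulrBl -!mulrA.
  rewrite big_split /= sumrB -!mulr_sumr sumx -!quadform_sum -!/(infomx H _).
  have := lambda_min_rayleigh w (infomx_sym dz); rewrite -/l.
  have := ler_wpM2l (ltW e0) (Hx w).
  lra.
have := le_trans low (opt _ dz'); rewrite -/l mulrC ler_pdivrMr // /n => le_l.
rewrite -(ler_pM2l e0); lra.
Qed.

End Designs.

Theorem theorem1 (R : realType) (X : finType) (hX : (0 < #|X|)%N) (m : nat)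
    (H : X -> 'M[R]_m) (hH : forall x, nonneg_definite (H x))
    (hns : exists xi0 : X -> R, design xi0 /\ infomx H xi0 \in unitmx)
    (xi : X -> R) (hxi : design xi) (hM : infomx H xi \in unitmx)
    (s : nat) (hs : (0 < s)%N)
    (v : 'I_s -> 'cV[R]_m)
    (hv : forall i, eigenvector (infomx H xi) (v i) /\ norm2 (v i) = 1)
    (alpha : 'I_s -> R) (halpha0 : forall i, 0 <= alpha i)
    (halpha1 : \sum_(i < s) alpha i = 1)
    (h : R)
    (hh : is_max (fun x => \tr (H x *m (\sum_(i < s) alpha i *: (v i *m (v i)^T)))) h) :
  lambda_min (infomx H xi) <= h /\
  (h = lambda_min (infomx H xi) -> E_optimal H xi) /\
  (lambda_min (infomx H xi) < h ->
    forall u : 'I_m -> 'cV[R]_m, ordered_eigenbasis (infomx H xi) u ->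
    forall x : X, (exists zeta : X -> R, E_optimal H zeta /\ supports x zeta) ->
    forall y : R, 0 <= y -> y < lambda_min (infomx H xi) / (h - lambda_min (infomx H xi)) ->
    1 <= g_fun H (infomx H xi) u h x y).
Proof.
have v1 i : dotp (v i) (v i) = 1.
  by have [_ nv] := hv i; rewrite -[LHS]sqr_sqrtr ?dotp_ge0 // -/(norm2 _) nv expr1n.
have m0 : (0 < m)%N.
  rewrite lt0n; apply/eqP => m0; have := v1 (Ordinal hs); rewrite dotpE.
  rewrite big1 => [/eqP|i _]; first by rewrite eq_sym oner_eq0.
  by have := ltn_ord i; rewrite [X in (_ < X)%N]m0.
have [_ h_ub] := hh.
have le_h zeta : design zeta -> lambda_min (infomx H zeta) <= h.
  exact: (lambda_min_le_design_bound hH v1 halpha0 halpha1 h_ub).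
split; first exact: le_h.
split=> [hE|lt_h u [uu uM] x [zeta [opt zx]] y y0 y_lt].
  by split=> // zeta /le_h; rewrite hE.
set M := infomx H xi in hM lt_h uM y_lt *; set l1 := lambda_min M in lt_h y_lt *.
have l1_gt0 : 0 < l1 by apply: lambda_min_gt0 => //; exact: infomx_psd.
pose d (i : 'I_m) := (lambda M i - h) * y + l1.
have d0 i : 0 < d i.
  have l1_le : l1 <= lambda M i.
    have := lambda_min_rayleigh (u i) (infomx_sym hH hxi).
    by rewrite (quadform_eigenvector (uM i)) uu eqxx !mulr1.
  move: y_lt; rewrite ltr_pdivlMr ?subr_gt0 // => y_lt.
  have := ler_wpM2r y0 l1_le; rewrite /d; lra.
set g := g_fun _ _ _ _ _ _.
have g0 : 0 <= g.
  apply: sumr_ge0 => i _; rewrite divr_ge0 ?(ltW (d0 i)) //.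
  by have [_] := hH x; apply.
(* The right-hand side is the quadratic form of g D, expanded below in the
   eigenbasis u. *)
have Hx w : quadform (H x) w
    <= (g * y) * quadform M w + g * (l1 - h * y) * dotp w w.
  have -> : (g * y) * quadform M w + g * (l1 - h * y) * dotp w w
      = g * \sum_i d i * dotp (u i) w ^+ 2.
    have ww : dotp w w = \sum_i 1 * dotp (u i) w ^+ 2.
      rewrite -(quadform_eigenbasis (A := 1%:M)) // => [|i].
        by rewrite /quadform mulmx1.
      by rewrite mul1mx scale1r.
    rewrite -2!mulrA -mulrDr; congr (_ * _).
    rewrite ww (quadform_eigenbasis _ uu uM) !mulr_sumr -big_split /=.
    by apply: eq_bigr => i _; rewrite /d; ring.
  rewrite {1}(orthonormal_expansion w uu).
  exact: psd_quadform_sum_le.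
have dz : design zeta by case: opt.
have := E_optimal_support_le hH m0 opt zx hxi (mulr_ge0 g0 y0) Hx.
have : l1 <= lambda_min (infomx H zeta) by case: opt => _; apply.
have := le_h _ dz.
set ls := lambda_min (infomx H zeta) => ls_h l1_ls ls_le.
rewrite -(ler_pM2r (lt_le_trans l1_gt0 l1_ls)) mul1r (le_trans ls_le) //.
have -> : g * y * ls + g * (l1 - h * y) = g * (l1 - y * (h - ls)) by ring.
rewrite ler_wpM2l // (le_trans _ l1_ls) // gerBl mulr_ge0 // subr_ge0 //.
Qed.
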